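(* Let $s,m\ge 1$ be integers, let $F_0,F_1:\mathbb{R}^m\to\mathbb{R}^m$, and consider the $s$-stage IMEX-Peer method $$w_{n+1}=Pw_n+\Delta t\,\hat Q F_0(w_n)+\Delta t\,\hat R F_0(w_{n+1})+\Delta t\,Q F_1(w_n)+\Delta t\,R F_1(w_{n+1}),\qquad \hat Q=Q+RS_1,\quad \hat R=RS_2, \qquad ( * )$$ with nodes $c_1,\dots,c_s$ and coefficient matrices $P,Q,R,S_1,S_2\in\mathbb{R}^{s\times s}$ as described in the context. Suppose the coefficient matrices satisfy $$Pe=e\qquad\text{and}\qquad S_1=(I_s-S_2)V_0V_1^{-1},$$ where $e=(1,\dots,1)^T\in\mathbb{R}^s$, $V_0=(c_i^{\,j-1})_{i,j=1}^s$ and $V_1=((c_i-1)^{j-1})_{i,j=1}^s$. Suppose also that, for given $w_n$ and all sufficiently small $\Delta t>0$, equation $( * )$ has a unique solution $w_{n+1}\in\mathbb{R}^{s\cdot m}$. Then the method is well-balanced: for all such $\Delta t$, if $w_n=[w_{n,1}^T,\dots,w_{n,s}^T]^T\in\mathbb{R}^{s\cdot m}$ satisfies $w_{n,1}=\dots=w_{n,s}$ and $$F_0(w_n)+F_1(w_n)=0,$$ then $w_{n+1}=w_n$.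
   Context: The method is a time integrator for the ODE system $u'=F_0(u)+F_1(u)$, $u(0)=u_0\in\mathbb{R}^m$. The stage vector is $w_n=[w_{n,1}^T,\dots,w_{n,s}^T]^T\in\mathbb{R}^{s\cdot m}$ with $w_{n,i}\in\mathbb{R}^m$ approximating $u(t_n+c_i\Delta t)$, where $t_n=n\Delta t$, $n\ge 0$, with constant step size $\Delta t>0$. The nodes $c_1,\dots,c_s\in\mathbb{R}$ are pairwise distinct and $c_s=1$. The matrix $R\in\mathbb{R}^{s\times s}$ is lower triangular with constant diagonal entry $\gamma>0$, and $S_2\in\mathbb{R}^{s\times s}$ is strictly lower triangular. The functions are applied stage-wise: $F_i(w_n)=[F_i(w_{n,1})^T,\dots,F_i(w_{n,s})^T]^T$ for $i=0,1$. An $s\times s$ matrix $A$ acting on $\mathbb{R}^{s\cdot m}$ means the Kronecker product $A\otimes I_m$. $I_s$ is the $s\times s$ identity matrix. In the matrices $V_0,V_1$ the convention $0^0=1$ is used (so their first columns equal $e$); both row and column indices run from $1$ to $s$. Definition (well-balanced): an $s$-stage IMEX-Peer method is called well-balanced if $F_0(w_n)+F_1(w_n)=0$ implies $w_{n+1}=w_n$, where $w_{n,1}=\dots=w_{n,s}$ (i.e. equality of all stages of $w_n$ is part of the assumption). *)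

(* Defs.v *)
From mathcomp Require Import all_boot all_order all_algebra.
From mathcomp Require Import mxtens.
From mathcomp Require Import reals.

Set Implicit Arguments.
Unset Strict Implicit.
Unset Printing Implicit Defensive.

Import Order.TTheory GRing.Theory Num.Theory.
Local Open Scope ring_scope.

(* A stage vector is a column of length s * m; its entry at index
   mxtens_index (i, j) = i * m + j is the j-th component of the i-th stage. *)
Section StageVectors.
Variables (R : realType) (s m : nat).

Definition stage (w : 'cV[R]_(s * m)) (i : 'I_s) : 'cV[R]_m :=
  \col_(j < m) w (mxtens_index (i, j)) 0.

Definition stagewise (F : 'cV[R]_m -> 'cV[R]_m) (w : 'cV[R]_(s * m)) :
    'cV[R]_(s * m) :=
  \col_(k < s * m) F (stage w (mxtens_unindex k).1) (mxtens_unindex k).2 0.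

Definition stage_act (A : 'M[R]_s) (w : 'cV[R]_(s * m)) : 'cV[R]_(s * m) :=
  (A *t (1%:M : 'M[R]_m)) *m w.

End StageVectors.

Section Peer.
Variables (R : realType) (s : nat).

(* Indices start at 0 here, so the exponent is j rather than j - 1;
   x ^+ 0 = 1 also for x = 0. *)
Definition V0 (c : 'I_s -> R) : 'M[R]_s := \matrix_(i, j) c i ^+ j.

Definition V1 (c : 'I_s -> R) : 'M[R]_s := \matrix_(i, j) (c i - 1) ^+ j.

Definition strictly_lower_triangular (A : 'M[R]_s) : Prop :=
  forall i j : 'I_s, (i <= j)%N -> A i j = 0.

(* [w'] is a solution of the (implicit) equation for one step of size [dt]
   starting from [w]. *)
Definition peer_step (P Q Rm S1 S2 : 'M[R]_s) (m : nat)
    (F0 F1 : 'cV[R]_m -> 'cV[R]_m) (dt : R) (w w' : 'cV[R]_(s * m)) : Prop :=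
  let Qhat := Q + Rm *m S1 in
  let Rhat := Rm *m S2 in
  w' = stage_act P w
       + dt *: stage_act Qhat (stagewise F0 w)
       + dt *: stage_act Rhat (stagewise F0 w')
       + dt *: stage_act Q (stagewise F1 w)
       + dt *: stage_act Rm (stagewise F1 w').

(* The step is a relation because it is implicit: the conclusion says that any
   result of the step is [w] itself. It is meant for a [w] from which the step
   has exactly one result. *)
Definition well_balanced_at (m : nat) (F0 F1 : 'cV[R]_m -> 'cV[R]_m)
    (step : 'cV[R]_(s * m) -> 'cV[R]_(s * m) -> Prop)
    (w : 'cV[R]_(s * m)) : Prop :=
  (forall i j : 'I_s, stage w i = stage w j) ->
  stagewise F0 w + stagewise F1 w = 0 ->
  forall w' : 'cV[R]_(s * m), step w w' -> w' = w.

End Peer.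

(* Main.v *)
Require Import Defs.
From mathcomp Require Import all_boot all_order all_algebra.
From mathcomp Require Import mxtens.
From mathcomp Require Import reals.

(** If all stages of [w] equal [v], then [w] is the tensor product [e *t v] with
    [e] the all-ones vector, and the stagewise values of [F0] and [F1] at [w]
    are [e *t F0 v] and [e *t F1 v].  A coefficient matrix acts on such a vector
    only through its row sums: it sends [e *t v] to [(A e) *t v].  So the whole
    step reduces to identities about row sums.  Under the balance condition
    [F1 v = - F0 v], substituting [w] for both arguments of the step leaves
    [(P e) *t v], which is [w] because [P e = e], and the multiple of [F0 v] by
    [(Q + R S1 + R S2 - Q - R) e = R (S1 + S2 - I) e], which vanishes as soon as
    [S1 e = (I - S2) e].

    The latter comes from the extrapolation matrix [V0 V1^-1], which has row sums
    1: extrapolation is exact for constants.  Concretely, the first columns of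
    [V0] and [V1] both equal [e], and [V1] is invertible since it is a
    Vandermonde matrix with distinct nodes, whence [V0 V1^-1 e = e].

    Thus [w] itself solves the implicit equation, and by uniqueness every
    solution is [w]. *)

Set Implicit Arguments.
Unset Strict Implicit.
Unset Printing Implicit Defensive.

Import Order.TTheory GRing.Theory Num.Theory.
Local Open Scope ring_scope.

Section Extrapolation.
Variables (R : realType) (s : nat).

(** The nodes [c i - 1] are distinct, so the Vandermonde determinant, the
    product of their differences, is nonzero. *)
Lemma V1_unitmx (c : 'I_s -> R) : injective c -> V1 c \in unitmx.
Proof.
move=> c_inj; pose a : 'rV[R]_s := \row_i (c i - 1).
have -> : V1 c = (Vandermonde s a)^T by apply/matrixP=> i j; rewrite !mxE.
rewrite unitmx_tr unitmxE det_Vandermonde unitfE.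
apply/prodf_neq0 => i _; apply/prodf_neq0 => j ltij.
rewrite !mxE subr_eq0 (inj_eq (addIr _)) (inj_eq c_inj) -val_eqE.
by rewrite gtn_eqF.
Qed.

(** Extrapolation from the nodes [c i - 1] to the nodes [c i] is exact for
    constants: the constant 1 has coordinate vector [delta_mx i0 0], with [i0]
    the first index, in the monomial basis, and evaluation at either set of nodes
    sends it to the all-ones vector. *)
Lemma extrapolation_const (c : 'I_s -> R) : (0 < s)%N -> injective c ->
  V0 c *m invmx (V1 c) *m (const_mx 1 : 'cV[R]_s) = const_mx 1.
Proof.
move=> s_gt0 c_inj; pose i0 := Ordinal s_gt0.
have V0e : V0 c *m delta_mx i0 0 = const_mx 1 :> 'cV[R]_s.
  by rewrite -colE; apply/matrixP=> i j; rewrite !mxE expr0.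
have V1e : V1 c *m delta_mx i0 0 = const_mx 1 :> 'cV[R]_s.
  by rewrite -colE; apply/matrixP=> i j; rewrite !mxE expr0.
by rewrite -{1}V1e -!mulmxA mulKmx ?V1_unitmx.
Qed.

End Extrapolation.

Section ConstantStages.
Variables (R : realType) (s m : nat).

(** The stage vector all of whose stages are [v], written as a tensor product so
    that the action of a coefficient matrix follows from the product rule
    [tensmx_mul]. *)
Definition const_stages (v : 'cV[R]_m) : 'cV[R]_(s * m) :=
  (const_mx 1 : 'cV[R]_s) *t v.

Lemma const_stagesE v k : const_stages v k 0 = v (mxtens_unindex k).2 0.
Proof. by rewrite !mxE mul1r; congr (v _ _); apply/ord_inj; rewrite ord1. Qed.

Lemma stage_const_stages v i : stage (const_stages v) i = v.
Proof.
by apply/matrixP=> j k; rewrite ord1 mxE const_stagesE mxtens_indexK.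
Qed.

Lemma const_stagesP (w : 'cV[R]_(s * m)) (i0 : 'I_s) :
  (forall i j : 'I_s, stage w i = stage w j) -> w = const_stages (stage w i0).
Proof.
move=> w_const; apply/matrixP=> k l; rewrite ord1 const_stagesE.
by rewrite (w_const i0 (mxtens_unindex k).1) mxE -surjective_pairing
  mxtens_unindexK.
Qed.

Lemma stagewise_const_stages (F : 'cV[R]_m -> 'cV[R]_m) v :
  stagewise F (const_stages v) = const_stages (F v).
Proof.
by apply/matrixP=> k l; rewrite ord1 const_stagesE mxE stage_const_stages.
Qed.

(** This reduces the step on constant stages to identities between row sums. *)
Lemma stage_act_const_stages (A : 'M[R]_s) v :
  stage_act A (const_stages v) = (A *m (const_mx 1 : 'cV[R]_s)) *t v.
Proof.
rewrite -{2}[v]mul1mx.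
(* The product has width [1 * 1], which is [1] by computation. *)
exact: (tensmx_mul A 1%:M (const_mx 1 : 'cV[R]_s) v).
Qed.

Lemma stage_actDl (A B : 'M[R]_s) (w : 'cV[R]_(s * m)) :
  stage_act (A + B) w = stage_act A w + stage_act B w.
Proof.
by rewrite /stage_act -mulmxDl; congr (_ *m _); apply/matrixP=> i j;
  rewrite !mxE mulrDl.
Qed.

Lemma stage_actN (A : 'M[R]_s) (w : 'cV[R]_(s * m)) :
  stage_act A (- w) = - stage_act A w.
Proof. exact: mulmxN. Qed.

(** The [Q] terms of [F0] and [F1] cancel directly. What remains of [F0] enters
    through [Rm *m (S1 + S2)], which acts like [Rm] on constant stages because
    [S1 + S2] has row sums 1, so it cancels the implicit [F1] term; the two
    sides of the step then differ by [P] alone, which fixes constant stages. *)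
Lemma peer_step_const_stages (P Q Rm S1 S2 : 'M[R]_s)
    (F0 F1 : 'cV[R]_m -> 'cV[R]_m) (dt : R) v :
  P *m (const_mx 1 : 'cV[R]_s) = const_mx 1 ->
  (S1 + S2) *m (const_mx 1 : 'cV[R]_s) = const_mx 1 ->
  const_stages (F1 v) = - const_stages (F0 v) ->
  peer_step P Q Rm S1 S2 F0 F1 dt (const_stages v) (const_stages v).
Proof.
move=> Pe Se F1v; rewrite /peer_step !stagewise_const_stages F1v.
have RSe : stage_act (Rm *m S1) (const_stages (F0 v))
    + stage_act (Rm *m S2) (const_stages (F0 v))
    = stage_act Rm (const_stages (F0 v)).
  by rewrite -stage_actDl -mulmxDr !stage_act_const_stages -mulmxA Se.
rewrite [stage_act P _]stage_act_const_stages Pe -/(const_stages v).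
rewrite !stage_actN -!addrA -!scalerDr stage_actDl -RSe.
set q := stage_act Q _; set a := stage_act _ _; set b := stage_act _ _.
by rewrite addrA -opprD [q + (a + b)]addrA subrr scaler0 addr0.
Qed.

End ConstantStages.

Theorem theorem2p1 (R : realType) (s m : nat) (hs : (0 < s)%N) (hm : (0 < m)%N)
  (F0 F1 : 'cV[R]_m -> 'cV[R]_m)
  (c : 'I_s -> R) (gamma : R) (P Q Rm S1 S2 : 'M[R]_s)
  (c_inj : injective c)
  (c_last : forall i : 'I_s, i.+1 = s -> c i = 1)
  (gamma_gt0 : 0 < gamma)
  (Rm_trig : is_trig_mx Rm)
  (Rm_diag : forall i : 'I_s, Rm i i = gamma)
  (S2_strict : strictly_lower_triangular S2)
  (P_e : P *m (const_mx 1 : 'cV[R]_s) = const_mx 1)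
  (S1_def : S1 = (1%:M - S2) *m V0 c *m invmx (V1 c))
  (w : 'cV[R]_(s * m)) (dt0 : R) (dt0_gt0 : 0 < dt0)
  (unique_step : forall dt : R, 0 < dt < dt0 ->
     exists! w' : 'cV[R]_(s * m), peer_step P Q Rm S1 S2 F0 F1 dt w w') :
  forall dt : R, 0 < dt < dt0 ->
    well_balanced_at F0 F1 (peer_step P Q Rm S1 S2 F0 F1 dt) w.
Proof.
move=> dt dt_bd w_const F_bal w' step_w'.
have [u [_ u_uniq]] := unique_step dt dt_bd.
have wE := const_stagesP (Ordinal hs) w_const.
set v := stage w _ in wE.
have F1v : const_stages s (F1 v) = - const_stages s (F0 v).
  apply/eqP; rewrite -addr_eq0 addrC -!stagewise_const_stages -wE.
  exact/eqP.
have Se : (S1 + S2) *m (const_mx 1 : 'cV[R]_s) = const_mx 1.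
  rewrite mulmxDl S1_def -!mulmxA [V0 c *m _]mulmxA extrapolation_const //.
  by rewrite -mulmxDl subrK mul1mx.
have step_w : peer_step P Q Rm S1 S2 F0 F1 dt w w.
  by rewrite wE; apply: peer_step_const_stages.
by rewrite -(u_uniq w' step_w') (u_uniq w step_w).
Qed.
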